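(* Let $\mathbb Z_{2,3}$ be the subring of $\mathbb Q$ consisting of the rational numbers whose reduced expression $\frac mn$ has $n$ neither even nor a multiple of $3$. Then $\operatorname{spec}(\mathbb Z_{2,3})$ is finite and admits a $\prec$-minimal open cover, but $\mathbb Z_{2,3}$ has no $\prec$-minimal generator. In particular, it is not true that every commutative unital ring $R$ for which $\operatorname{spec}(R)$ has a $\prec$-minimal open cover has a $\prec$-minimal generator.
   Context: For families of sets, $\mathcal A\prec\mathcal B$ means that for every $A\in\mathcal A$ there is $B\in\mathcal B$ with $A\subseteq B$. A generator of a commutative unital ring $R$ is a finite set $\mathcal I$ of ideals of $R$ with $\sum_{I\in\mathcal I}I=R$; it is $\prec$-minimal if $\mathcal I\prec\mathcal J$ for every generator $\mathcal J$ of $R$. $\operatorname{spec}(R)$ is the set of prime ideals of $R$ with the Zariski topology, whose open sets are the sets $U_I$ of prime ideals not containing a given ideal $I$. Open covers of a compact topological space are assumed finite; an open cover $\mathcal U$ is $\prec$-minimal if $\mathcal U\prec\mathcal V$ for every open cover $\mathcal V$. *)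

(* Defs.v *)
From HB Require Import structures.
From mathcomp Require Import all_boot all_order all_algebra.
From mathcomp Require Import ring.
From mathcomp Require Import all_classical.
From mathcomp Require Import topology_structure.

Set Implicit Arguments.
Unset Strict Implicit.
Unset Printing Implicit Defensive.
Import Order.TTheory GRing.Theory Num.Theory.
Local Open Scope classical_set_scope.
Local Open Scope ring_scope.

Definition family_prec (T : Type) (A B : set (set T)) : Prop :=
  forall X, A X -> exists2 Y, B Y & X `<=` Y.

(* The unit ideal is an ideal, unlike in mathcomp's ring_quotient, and the
   zero ring is a commutative unital ring, hence comPzRingType. *)
Definition ideal (R : comPzRingType) (I : set R) : Prop :=
  I 0 /\ forall a x y, I x -> I y -> I (a * x + y).

Definition prime_ideal (R : comPzRingType) (P : set R) : Prop :=
  [/\ ideal P, ~ P 1 & forall x y, P (x * y) -> P x \/ P y].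

(* The elements \sum_(I in F) x_I with x_I in I. If F is infinite, the sum
   over F is the sum of the nonzero x_I when these are finitely many, and 0
   otherwise, so that ideal_sum F is the sum of the family in this case too. *)
Definition ideal_sum (R : comPzRingType) (F : set (set R)) : set R :=
  [set z | exists2 x : set R -> R,
     (forall I, F I -> I (x I)) & z = \sum_(I \in F) x I].

Definition generator (R : comPzRingType) (F : set (set R)) : Prop :=
  [/\ finite_set F, F `<=` @ideal R & ideal_sum F = setT].

Definition minimal_generator (R : comPzRingType) (F : set (set R)) : Prop :=
  generator F /\ forall G, generator G -> family_prec F G.

(* Only used for compact T, such as spec R, where open covers are finite by
   convention. *)
Definition open_cover (T : topologicalType) (U : set (set T)) : Prop :=
  [/\ finite_set U, U `<=` open & \bigcup_(A in U) A = setT].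

Definition minimal_open_cover (T : topologicalType) (U : set (set T)) : Prop :=
  open_cover U /\ forall V, open_cover V -> family_prec U V.

Record spec (R : comPzRingType) := Spec {
  spec_set :> set R;
  spec_prime : prime_ideal spec_set
}.

HB.instance Definition _ (R : comPzRingType) := gen_eqMixin (spec R).
HB.instance Definition _ (R : comPzRingType) := gen_choiceMixin (spec R).

Definition zariski (R : comPzRingType) (I : set R) : set (spec R) :=
  [set P | ~ (I `<=` P)].

Definition zariski_open (R : comPzRingType) : set (set (spec R)) :=
  [set zariski I | I in @ideal R].

Section ZariskiTopology.
Variable R : comPzRingType.
Implicit Types I J : set R.

Lemma idealMl I a x : ideal I -> I x -> I (a * x).
Proof. by move=> [I0 IM] Ix; rewrite -[_ * _]addr0; exact: IM. Qed.

Lemma zariski_openT : zariski_open [set: spec R].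
Proof.
exists setT; first by split.
apply/seteqP; split=> // P _ /= /(_ 1 Logic.I).
by case: (spec_prime P).
Qed.

Lemma zariski_openI : setI_closed (@zariski_open R).
Proof.
move=> _ _ [I idI <-] [J idJ <-]; exists (I `&` J).
  case: (idI) (idJ) => I0 IM [J0 JM]; split=> // a x y [Ix Jx] [Iy Jy].
  by split; [exact: IM|exact: JM].
rewrite /zariski; apply/seteqP; split=> P /=.
  by move=> nP; split=> sP; apply: nP => x [Ix Jx]; exact: sP.
move=> [/existsNP[x /not_implyP[Ix nPx]] /existsNP[y /not_implyP[Jy nPy]]].
move=> sP; have /sP : (I `&` J) (x * y).
  by split; [rewrite mulrC|]; exact: idealMl.
by case: (spec_prime P) => _ _ pP /pP[].
Qed.

Lemma zariski_open_bigU (K : Type) (f : K -> set (spec R)) :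
  (forall k, zariski_open (f k)) -> zariski_open (\bigcup_k f k).
Proof.
move=> fo; pose g k := sval (cid2 (fo k)).
have gf k : zariski (g k) = f k by rewrite /g; case: cid2.
exists (smallest (@ideal R) (\bigcup_k g k)).
  split; first by move=> J [[J0 _] _].
  move=> a x y sx sy J [idJ gJ]; case: (idJ) => _; apply.
    exact: sx.
  exact: sy.
rewrite /zariski; apply/seteqP; split=> P /=.
  apply: contra_notP => nP; apply: smallest_sub; first by case: (spec_prime P).
  move=> x [k _ gx]; apply: contrapT => nPx; apply: nP; exists k => //.
  by rewrite -gf => /(_ x gx).
move=> [k _]; rewrite -gf => nP sP; apply: nP => x gx.
by apply: sP => J [_ gJ]; apply: gJ; exists k.
Qed.

HB.instance Definition _ := isOpenTopological.Build (spec R)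
  zariski_openT zariski_openI zariski_open_bigU.

Lemma spec_openE : @open (spec R) = @zariski_open R.
Proof. by []. Qed.

End ZariskiTopology.

Definition Z23_pred : {pred rat} :=
  fun q => ~~ (2 %| denq q)%Z && ~~ (3 %| denq q)%Z.

Lemma dvdz_denq (q : rat) (d n : int) : q * d%:~R = n%:~R -> (denq q %| d)%Z.
Proof.
move=> qd; rewrite -(@Gauss_dvdzr _ (numq q)); last first.
  by rewrite coprimezE coprime_sym coprime_num_den.
apply/dvdzP; exists n; apply/eqP; rewrite -(eqr_int rat) !intrM -qd numqE.
by rewrite mulrAC.
Qed.

Lemma Z23_pred_dvd (q : rat) (d : int) :
  (denq q %| d)%Z -> ~~ (2 %| d)%Z && ~~ (3 %| d)%Z -> q \in Z23_pred.
Proof.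
move=> qd /andP[nd2 nd3]; apply/andP; split.
  by apply: contra nd2 => /dvdz_trans; apply.
by apply: contra nd3 => /dvdz_trans; apply.
Qed.

Lemma Z23_predMden (p q : rat) : p \in Z23_pred -> q \in Z23_pred ->
  ~~ (2 %| denq p * denq q)%Z && ~~ (3 %| denq p * denq q)%Z.
Proof.
move=> /andP[p2 p3] /andP[q2 q3]; rewrite !dvdzE !abszM.
by rewrite !Euclid_dvdM // !negb_or; apply/andP; split; apply/andP.
Qed.

Lemma Z23_subring_closed : subring_closed Z23_pred.
Proof.
split=> // p q pZ qZ; apply: Z23_pred_dvd (Z23_predMden pZ qZ).
  apply: (@dvdz_denq _ _ (numq p * denq q - numq q * denq p)).
  by rewrite intrB !intrM !numqE; ring.
apply: (@dvdz_denq _ _ (numq p * numq q)).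
by rewrite !intrM !numqE; ring.
Qed.

HB.instance Definition _ := GRing.isSubringClosed.Build rat Z23_pred
  Z23_subring_closed.

Record Z23 := MkZ23 { Z23_val :> rat; _ : Z23_val \in Z23_pred }.

HB.instance Definition _ := [isSub for Z23_val].
HB.instance Definition _ := [Choice of Z23 by <:].
HB.instance Definition _ := [SubChoice_isSubComNzRing of Z23 by <:].

(* Main.v *)
Require Import Defs.
From HB Require Import structures.
From mathcomp Require Import all_boot all_order all_algebra.
From mathcomp Require Import ring.
From mathcomp Require Import all_classical.
From mathcomp Require Import topology_structure.
Local Open Scope classical_set_scope.

(* A finite space has the minimal open cover formed by the minimal open
   neighborhoods of its points, so it suffices that spec Z_{2,3} is finite: as
   every prime p > 3 is a unit, a prime ideal is determined by whether it
   contains 2 and whether it contains 3. On the other hand (2^k) and (3^k)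
   generate Z_{2,3} for every k, so that every ideal of a minimal generator
   lies, for each k, in (2^k) or in (3^k). A nonzero element with reduced
   numerator m is in neither for k = |m|; hence these ideals are all 0, and
   their sum is not the whole ring. *)

Set Implicit Arguments.
Unset Strict Implicit.
Import Order.TTheory GRing.Theory Num.Theory.
Local Open Scope ring_scope.

Lemma finite_space_minimal_open_cover (T : topologicalType) :
  finite_set [set: T] -> exists U : set (set T), minimal_open_cover U.
Proof.
move=> finT.
pose N (x : T) := \bigcap_(A in [set A | open A /\ A x]) A.
have Nopen x : open (N x).
  (* [N x] is an intersection of possibly infinitely many open sets. One neighborhood of [x] per
     point [y], missing [y] when [y] lies outside [N x], already cuts out [N x], and finiteness of
     [T] makes this a finite intersection. *)
  have sep (y : T) : exists A : set T, open A /\ A x /\ (~ N x y -> ~ A y).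
    have [Ny|nNy] := pselect (N x y).
      by exists setT; split=> //; exact: openT.
    have /existsNP[A /not_implyP[[oA Ax] nAy]] := nNy.
    by exists A.
  have [A hA] := choice sep.
  have -> : N x = \bigcap_(y in [set: T]) A y; last first.
    have [D ->] := finite_fsetP.1 finT; rewrite openE => p Ap.
    apply: filter_bigI => y yD; apply: open_nbhs_nbhs; split; last exact: Ap.
    by case: (hA y).
  apply/seteqP; split=> y.
    by move=> Ny z _; case: (hA z) => oA [Ax _]; exact: Ny.
  move=> Ay; apply: contrapT => nNy; case: (hA y) => _ [_ /(_ nNy)].
  by apply; exact: Ay.
exists (range N); split.
  split; first exact: finite_image.
    by move=> _ [x _ <-].
  by apply/seteqP; split=> // x _; exists (N x) => //; move=> A [].
move=> V [_ oV cV] _ [x _ <-].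
have : [set: T] x by [].
rewrite -cV => -[A VA Ax]; exists A => //.
by move=> y; apply; split=> //; exact: oV.
Qed.

Definition principal (R : comPzRingType) (a : R) : set R :=
  range (fun y => a * y).

Lemma principal_ideal (R : comPzRingType) (a : R) : ideal (principal a).
Proof.
split; first by exists 0; rewrite ?mulr0.
move=> b _ _ [x _ <-] [y _ <-]; exists (b * x + y) => //.
by rewrite mulrDr mulrCA.
Qed.

Lemma generator_set2 (R : comPzRingType) (A B : set R) (a b : R) :
  ideal A -> ideal B -> A a -> B b -> a + b = 1 -> generator [set A; B].
Proof.
move=> idA idB Aa Bb ab1; split; first exact: finite_set2.
  by move=> _ [] ->.
apply/seteqP; split=> // z _.
(* If [A = B], as happens for the zeroth powers below, the family has one member and the sum one
   term, which must then be all of [z] rather than [z * a] or [z * b]. *)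
have [eqAB|neqAB] := eqVneq A B.
  rewrite -eqAB in Bb *; rewrite setUid.
  exists (fun=> z); last by rewrite fsbig_set1.
  move=> _ ->; rewrite -[z]mulr1 -ab1; apply: idealMl => //.
  by rewrite -[a]mul1r; case: idA => _; exact.
exists (fun I => z * (if I == A then a else b)).
  move=> I [] ->; apply: idealMl => //; first by rewrite eqxx.
  by rewrite eq_sym (negbTE neqAB).
rewrite fsbigU ?fsbig_set1 /=; last 3 first.
- exact: finite_set1.
- exact: finite_set1.
- by move=> I [-> AB]; rewrite AB eqxx in neqAB.
by rewrite eqxx eq_sym (negbTE neqAB) -mulrDr ab1 mulr1.
Qed.

(** Strong induction, splitting off the least prime factor [pdiv n]; [n = 1] is excluded because [P]
    is proper. *)
Lemma prime_ideal_nat (R : comPzRingType) (P : set R) (n : nat) :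
  prime_ideal P -> (0 < n)%N -> P n%:R ->
  exists2 p, prime p /\ (p %| n)%N & P p%:R.
Proof.
move=> [idP nP1 pP]; elim/ltn_ind: n => n IH n0 Pn.
have [n1|n1] := leqP n 1.
  by case: nP1; case: n n0 n1 Pn {IH} => [|[]].
have pd := pdiv_prime n1; have dn := pdiv_dvd n.
move: Pn; rewrite -{1}(divnK dn) natrM => /pP[|Pp]; last first.
  by exists (pdiv n).
move=> /IH[||p [pp pn] Pp]; first by rewrite ltn_Pdiv ?prime_gt1.
  by rewrite divn_gt0 ?pdiv_gt0 // dvdn_leq.
by exists p => //; split=> //; rewrite (dvdn_trans pn) ?dvdn_div.
Qed.

Lemma Z23_mul_denq (x : Z23) : x * `|denq x|%N%:R = (numq x)%:~R.
Proof.
apply: val_inj; rewrite rmorphM rmorph_int rmorph_nat /= numqE.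
by rewrite -[RHS]/(_ * (denq x)%:~R) -{2}[denq x]absz_denq.
Qed.

Lemma Z23_nat_inv (n : nat) : ~~ (2 %| n)%N -> ~~ (3 %| n)%N ->
  exists y : Z23, y * n%:R = 1.
Proof.
move=> n2 n3.
have n0 : (n%:R : rat) != 0 by rewrite pnatr_eq0; apply: contraNneq n2 => ->.
have yP : (n%:R^-1 : rat) \in Z23_pred.
  apply: (@Z23_pred_dvd _ n); last by rewrite !dvdzE n2 n3.
  by apply: (@dvdz_denq _ _ 1); rewrite mulVf.
by exists (MkZ23 yP); apply: val_inj; rewrite rmorphM rmorph_nat /= mulVf.
Qed.

(** Denominators are units, so [x] may be replaced by its numerator, some prime factor of which lies
    in [P] unless it is 0; primes other than 2 and 3 are units. The value [d = 0] accounts for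
    [x = 0]. Hence [P] is determined by its members among 2 and 3. *)
Lemma Z23_prime_idealE (P : set Z23) (x : Z23) : prime_ideal P ->
  P x <-> exists2 d : nat,
    d \in [:: 0; 2; 3]%N /\ (d %| `|numq x|)%N & P d%:R.
Proof.
move=> primeP; case: (primeP) => idP nP1 _; split=> [Px|[d [_ dx] Pd]].
  have Pn : P `|numq x|%N%:R.
    rewrite -[_%:R]/(`|numq x|%N%:Z%:~R) abszEsg rmorphM /= -Z23_mul_denq.
    by rewrite [x * _]mulrC mulrA; exact: idealMl.
  have [x0|x0] := eqVneq (numq x) 0.
    by exists 0%N; [rewrite x0|case: idP].
  have [|p [pp px] Pp] := prime_ideal_nat primeP _ Pn; first by rewrite absz_gt0.
  exists p => //; split=> //; rewrite !inE.
  have [_|p2] := eqVneq p 2%N; first by rewrite orbT.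
  have [_|p3] := eqVneq p 3%N; first by rewrite !orbT.
  have [y yp1] : exists y : Z23, y * p%:R = 1.
    by apply: Z23_nat_inv; rewrite dvdn_prime2 // eq_sym.
  by case: nP1; rewrite -yp1; exact: idealMl.
have /andP[x2 x3] := valP x.
have [y yx] := Z23_nat_inv x2 x3.
have /dvdnP[e xe] := dx.
(* Here [y] inverts the denominator of [x], and [e * d] is the absolute value of its numerator. *)
have -> : x = y * (sgz (numq x))%:~R * e%:R * d%:R.
  rewrite -[LHS]mulr1 -{1}yx mulrCA Z23_mul_denq [numq x in LHS]intEsg xe.
  by rewrite PoszM !intrM -!pmulrn !mulrA.
exact: idealMl.
Qed.

Lemma spec_inj (R : comPzRingType) : injective (@spec_set R).
Proof.
move=> [P pP] [Q pQ] /= PQ; case: _ / PQ in pQ *; congr Spec.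
exact: Prop_irrelevance.
Qed.

Lemma finite_spec_Z23 : finite_set [set: spec Z23].
Proof.
pose f (P : spec Z23) := (`[< spec_set P 2%:R >], `[< spec_set P 3%:R >]).
rewrite -(preimage_setT f); apply: finite_preimage => // P Q _ _ [P2 P3].
apply: spec_inj; apply/seteqP.
have PQ (d : nat) : d \in [:: 0; 2; 3]%N -> spec_set P d%:R <-> spec_set Q d%:R.
  rewrite !inE => /or3P[] /eqP ->.
  - by case: (spec_prime P) (spec_prime Q) => [[? _] _ _] [[? _] _ _].
  - by split=> /asboolP; [rewrite P2|rewrite -P2] => /asboolP.
  - by split=> /asboolP; [rewrite P3|rewrite -P3] => /asboolP.
by split=> x /Z23_prime_idealE -/(_ (spec_prime _))[d [dS dx] Pd];
  apply/Z23_prime_idealE; [exact: spec_prime| |exact: spec_prime|];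
  exists d => //; apply/PQ.
Qed.

(** Clearing denominators in [x = p ^ k * y] leaves the factor [denq y] beside [numq x]; it is
    coprime to [p], so Gauss's lemma removes it. *)
Lemma Z23_principal_numq (p k : nat) (x : Z23) : p \in [:: 2; 3]%N ->
  principal (p%:R ^+ k) x -> (p ^ k %| `|numq x|)%N.
Proof.
move=> pS [y _ yx].
have /andP[y2 y3] := valP y.
have cop : coprime (p ^ k) `|denq y|%N.
  apply: coprimeXl; move: pS; rewrite !inE => /orP[] /eqP ->.
    by rewrite prime_coprime.
  by rewrite prime_coprime.
rewrite -(Gauss_dvdl _ cop).
have -> : (`|numq x| * `|denq y| = p ^ k * `|(numq y * denq x)%R|)%N; last first.
  exact: dvdn_mulr.
rewrite -abszM -[(p ^ k)%N]/(`|(p ^ k)%N%:Z|)%N -abszM; congr (`|_|%N).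
have vx : Z23_val x = (p ^ k)%N%:R * Z23_val y.
  by rewrite -yx -[LHS]/(val _) rmorphM rmorphXn rmorph_nat natrX.
apply/eqP; rewrite -(eqr_int rat) !intrM !numqE {1}vx; apply/eqP.
by rewrite -pmulrn; ring.
Qed.

Lemma Z23_generator_pow (k : nat) :
  generator [set principal (2%:R ^+ k : Z23); principal (3%:R ^+ k)].
Proof.
have /coprimeP : coprime (2 ^ k) (3 ^ k) by rewrite coprimeXl ?coprimeXr.
rewrite expn_gt0 => /(_ isT)[[u v] /= uv].
apply: (@generator_set2 _ _ _ (2%:R ^+ k * u%:R) (3%:R ^+ k * - v%:R)).
- exact: principal_ideal.
- exact: principal_ideal.
- by exists u%:R.
- by exists (- v%:R).
(* The Bezout relation [uv] uses truncated subtraction; its value 1 is positive, so nothing was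
   truncated and it carries over to the ring. *)
rewrite mulrN -!natrX -!natrM mulnC (mulnC (3 ^ k)%N) -natrB ?uv //.
by rewrite ltnW // -subn_gt0 uv.
Qed.

Lemma Z23_no_minimal_generator :
  ~ exists F : set (set Z23), minimal_generator F.
Proof.
move=> [F [[_ _ sumF] minF]].
have F0 I x : F I -> I x -> x = 0.
  move=> FI Ix; apply/eqP; apply: contraT => x0.
  have nx0 : (0 < `|numq x|)%N by rewrite absz_gt0 numq_eq0.
  (* With exponent [k = |numq x|], divisibility of [k > 0] by [p ^ k] would contradict
     [k < p ^ k]. *)
  have [J JG IJ] := minF _ (Z23_generator_pow `|numq x|) I FI.
  suff [p pS /(dvdn_leq nx0)] : exists2 p : nat, p \in [:: 2; 3]%N &
      (p ^ `|numq x| %| `|numq x|)%N.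
    by rewrite leqNgt ltn_expl //; move: pS; rewrite !inE => /orP[] /eqP ->.
  have := IJ x Ix; case: JG => -> /Z23_principal_numq h.
    by exists 2%N => //; exact: h.
  by exists 3%N => //; exact: h.
have : [set: Z23] 1 by [].
rewrite -sumF => -[x Fx]; rewrite fsbig1 => [/eqP|I FI].
  by rewrite oner_eq0.
exact: F0 (FI) (Fx I FI).
Qed.

Theorem mainTheorem6 :
  [/\ finite_set [set: spec Z23],
      exists U : set (set (spec Z23)), minimal_open_cover U,
      ~ (exists F : set (set Z23), minimal_generator F) &
      ~ (forall R : comPzRingType,
           (exists U : set (set (spec R)), minimal_open_cover U) ->
           exists F : set (set R), minimal_generator F)].
Proof.
have cover := finite_space_minimal_open_cover finite_spec_Z23.
split.
- exact: finite_spec_Z23.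
- exact: cover.
- exact: Z23_no_minimal_generator.
- by move=> H; apply: Z23_no_minimal_generator; exact: H.
Qed.
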